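(* Let $N\ge1$ be an integer, let $D\in\mathcal{D}_{N,1}$, and suppose that $G\in L^2(\mathbb{R}^3\times\mathbb{R}^3)$ is such that $D(\mathbf{r},\mathbf{s})=(G^\dagger*G)(\mathbf{r},\mathbf{s})$ almost everywhere in $\mathbb{R}^3\times\mathbb{R}^3$. Then, for every $\Gamma\in\mathcal{D}_N$ such that $\Gamma\mapsto D$, it holds that $$\rho_\Gamma(\mathbf{r})=(G^\dagger*G)(\mathbf{r},\mathbf{r})$$ for almost every $\mathbf{r}\in\mathbb{R}^3$.
   Context: $\mathcal{D}_N$ is the set of (spin-free) mixed $N$-electron states $\Gamma(\mathbf{r}_{1:N},\mathbf{s}_{1:N})=\sum_ip_i\Psi_i(\mathbf{r}_{1:N})\Psi_i^*(\mathbf{s}_{1:N})$, a countable convex combination ($p_i\ge0$, $\sum_ip_i=1$) of normalized $\Psi_i\in L^2(\mathbb{R}^{3N})$, each either totally symmetric or totally antisymmetric under permutations of its $N$ arguments in $\mathbb{R}^3$; representatives $\Psi_i$ are pointwise-defined functions. Its 1-rdm is $D_\Gamma(\mathbf{r},\mathbf{s})=N\sum_ip_i\int_{\mathbb{R}^{3N-3}}\Psi_i(\mathbf{r},\mathbf{r}_{2:N})\Psi_i^*(\mathbf{s},\mathbf{r}_{2:N})\,d\mathbf{r}_{2:N}$, and its density is $\rho_\Gamma(\mathbf{r})=D_\Gamma(\mathbf{r},\mathbf{r})=N\sum_ip_i\int|\Psi_i(\mathbf{r},\mathbf{r}_{2:N})|^2\,d\mathbf{r}_{2:N}$, defined for a.e.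 $\mathbf{r}$. $\Gamma\mapsto D$ means $\|D_\Gamma-D\|_{L^2(\mathbb{R}^3\times\mathbb{R}^3)}=0$, i.e. $D_\Gamma=D$ almost everywhere on $\mathbb{R}^3\times\mathbb{R}^3$. $\mathcal{D}_{N,1}$ (the set of 1-rdms of mixed $N$-electron states) consists of those $D\in L^2(\mathbb{R}^3\times\mathbb{R}^3)$ that are kernels of trace-class operators on $L^2(\mathbb{R}^3)$, are Hermitian ($D(\mathbf{r},\mathbf{s})=D(\mathbf{s},\mathbf{r})^*$ a.e.), satisfy $0\le\iint\phi^*(\mathbf{r})D(\mathbf{r},\mathbf{s})\phi(\mathbf{s})\,d\mathbf{r}\,d\mathbf{s}\le2\|\phi\|_2^2$ for all $\phi\in L^2(\mathbb{R}^3)$, and have $\operatorname{Tr}D=N$. Kernel product: $(B*C)(x,y)=\int B(x,z)C(z,y)\,dz$, and $G^\dagger(\mathbf{r},\mathbf{u})=G(\mathbf{u},\mathbf{r})^*$, so $(G^\dagger*G)(\mathbf{r},\mathbf{s})=\int_{\mathbb{R}^3}G(\mathbf{u},\mathbf{r})^*G(\mathbf{u},\mathbf{s})\,d\mathbf{u}$, a pointwise expression defined for a.e. $\mathbf{r}$ and a.e. $\mathbf{s}$. *)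

(* Defs.v *)
From HB Require Import structures.
From mathcomp Require Import all_boot all_order all_algebra all_fingroup.
From mathcomp Require Import all_classical all_reals all_analysis.
From mathcomp Require Export complex.

Set Implicit Arguments.
Unset Strict Implicit.
Unset Printing Implicit Defensive.

Import Order.TTheory GRing.Theory Num.Theory.
Import numFieldNormedType.Exports.

Local Open Scope classical_set_scope.
Local Open Scope ring_scope.
Local Open Scope complex_scope.

(* Valued in R, unlike the library's 'Re and 'Im. *)
Local Notation cRe := (@complex.Re _).
Local Notation cIm := (@complex.Im _).

(* The canonical sigma-finite structure that the library attaches to m1 \x m2
   only unifies when m1 and m2 are subprobabilities, hence this lemma. *)
Lemma sigma_finite_product d1 d2 (T1 : measurableType d1)
    (T2 : measurableType d2) (R : realType)
    (m1 : {sigma_finite_measure set T1 -> \bar R})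
    (m2 : {sigma_finite_measure set T2 -> \bar R}) :
  sigma_finite setT (m1 \x m2)%E.
Proof.
have /sigma_finiteP[F [TF ndF Foo]] := sigma_finiteT m1.
have /sigma_finiteP[G [TG ndG Goo]] := sigma_finiteT m2.
exists (fun n => F n `*` G n).
  rewrite -setXTT TF TG predeqE => -[x y]; split.
    move=> [/= [n _ Fnx] [k _ Gky]]; exists (maxn n k) => //; split.
    - by move: x Fnx; exact/subsetPset/ndF/leq_maxl.
    - by move: y Gky; exact/subsetPset/ndG/leq_maxr.
  by move=> [n _ []/= ? ?]; split; exists n.
move=> k; have [? ?] := Foo k; have [? ?] := Goo k.
split; first exact: measurableX.
by rewrite product_measure1E// lte_mul_pinfty// ge0_fin_numE.
Qed.

(* The power of a sigma-finite measure, on the product sigma-algebra of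
   n.-tuple T. *)
Section cons_measure.
Context d (T : measurableType d) (R : realType).
Variables (mu : {sigma_finite_measure set T -> \bar R}) (n : nat).
Variable nu : {sigma_finite_measure set (n.-tuple T) -> \bar R}.

Definition cons_pair (x : T * n.-tuple T) : n.+1.-tuple T :=
  [tuple of x.1 :: x.2].

Lemma measurable_cons_pair : measurable_fun setT cons_pair.
Proof. exact: (measurable_cons measurable_fst measurable_snd). Qed.

Definition cons_measure : set (n.+1.-tuple T) -> \bar R :=
  pushforward (mu \x nu)%E cons_pair.

Let cons_measure0 : cons_measure set0 = 0%E.
Proof. by rewrite /cons_measure /pushforward preimage_set0 measure0. Qed.

Let cons_measure_ge0 A : (0 <= cons_measure A)%E.
Proof. by rewrite /cons_measure /pushforward measure_ge0. Qed.

Let measurable_cons_preimage A : measurable A -> measurable (cons_pair @^-1` A).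
Proof.
by move=> mA; rewrite -[X in measurable X]setTI; exact: measurable_cons_pair.
Qed.

Let cons_measure_sigma_additive : semi_sigma_additive cons_measure.
Proof.
move=> F mF tF mUF; rewrite /cons_measure /pushforward preimage_bigcup.
apply: measure_semi_sigma_additive.
- by move=> k; exact: measurable_cons_preimage.
- apply/trivIsetP => /= i j _ _ ij; rewrite -preimage_setI.
  by move/trivIsetP : tF => /(_ _ _ _ _ ij) ->//; rewrite preimage_set0.
- by rewrite -preimage_bigcup; exact: measurable_cons_preimage.
Qed.

HB.instance Definition _ := isMeasure.Build _ _ _ cons_measure
  cons_measure0 cons_measure_ge0 cons_measure_sigma_additive.

Let cons_measure_sigma_finite : sigma_finite setT cons_measure.
Proof.
have [F TF mF] := sigma_finite_product mu nu.
pose uncons (t : n.+1.-tuple T) : T * n.-tuple T :=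
  (thead t, [tuple of behead t]).
have unconsK : cancel uncons cons_pair.
  by move=> t; rewrite /uncons /cons_pair /= [RHS]tuple_eta; apply/val_inj.
have consK : cancel cons_pair uncons.
  move=> -[x t]; rewrite /uncons /cons_pair /=; congr pair.
  exact/val_inj.
have muncons : measurable_fun setT uncons.
  apply: measurable_fun_pair; first exact: measurable_tnth.
  exact: measurable_behead.
exists (fun k => uncons @^-1` F k).
  by rewrite -preimage_bigcup -TF preimage_setT.
move=> k; have [mFk Fk] := mF k; split.
  by rewrite -[X in measurable X]setTI; exact: muncons.
rewrite /cons_measure /pushforward -comp_preimage.
by rewrite (_ : uncons \o cons_pair = id)//; apply/funext => x /=.
Qed.

HB.instance Definition _ := Measure_isSigmaFinite.Build _ _ _ cons_measure
  cons_measure_sigma_finite.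

End cons_measure.

Section tuple_measure.
Context d (T : measurableType d) (R : realType).
Variable mu : {sigma_finite_measure set T -> \bar R}.

Fixpoint tuple_measure n : {sigma_finite_measure set (n.-tuple T) -> \bar R} :=
  if n is m.+1 then cons_measure mu (tuple_measure m)
  else \d_([tuple] : 0.-tuple T).

End tuple_measure.

Section complex_integration.
Context d (T : measurableType d) (R : realType).
Variable mu : {measure set T -> \bar R}.
Implicit Types f g : T -> R[i].

(* Componentwise, and hence 0 in a component that is not integrable. *)
Definition cintegral f : R[i] :=
  (\int[mu]_x cRe (f x)) +i* (\int[mu]_x cIm (f x)).

Definition cmeasurable f :=
  measurable_fun setT (cRe \o f) /\ measurable_fun setT (cIm \o f).

Definition sqL2norm f : \bar R := (\int[mu]_x (Normc.normc (f x) ^+ 2)%:E)%E.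

Definition L2 f := cmeasurable f /\ (sqL2norm f < +oo)%E.

Definition inner f g : R[i] := cintegral (fun x => (f x)^* * g x).

End complex_integration.

Section complex_series.
Context (R : realType).
Implicit Types (u : nat -> R[i]) (z : R[i]).

Definition cseries_cvg u z :=
  series (cRe \o u) @ \oo --> cRe z /\
  series (cIm \o u) @ \oo --> cIm z.

Definition cseries u : R[i] :=
  limn (series (cRe \o u)) +i* limn (series (cIm \o u)).

End complex_series.

(* Operators on L2 mu, acting on representatives and specified up to almost
   everywhere equality. *)
Section operators.
Context d (T : measurableType d) (R : realType).
Variable mu : {measure set T -> \bar R}.
Implicit Types (A S : (T -> R[i]) -> (T -> R[i])) (f g : T -> R[i]).

Definition bounded_operator A :=
  [/\ forall f, L2 mu f -> L2 mu (A f),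
      forall (a : R[i]) f g, L2 mu f -> L2 mu g ->
        \forall x \ae mu, A (fun y => a * f y + g y) x = a * A f x + A g x
    & exists c : R, forall f, L2 mu f ->
        (sqL2norm mu (A f) <= c%:E * sqL2norm mu f)%E].

Definition adjoint A S :=
  bounded_operator S /\
  forall f g, L2 mu f -> L2 mu g -> inner mu f (A g) = inner mu (S f) g.

(* The order of R[i] makes this say that the number is real as well. *)
Definition positive_operator A :=
  bounded_operator A /\ forall f, L2 mu f -> 0 <= inner mu f (A f).

(* B is |A|, the positive square root of the product of the adjoint of A
   and A. *)
Definition absolute_value A B :=
  positive_operator B /\
  exists2 S, adjoint A S &
    forall f, L2 mu f -> \forall x \ae mu, B (B f) x = S (A f) x.

Definition orthonormal_basis (e : nat -> T -> R[i]) :=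
  [/\ forall k, L2 mu (e k),
      forall j k, inner mu (e j) (e k) = (j == k)%:R
    & forall f, L2 mu f -> (forall k, inner mu (e k) f = 0) ->
        \forall x \ae mu, f x = 0].

Definition trace_class A :=
  bounded_operator A /\
  exists2 B, absolute_value A B &
    forall e, orthonormal_basis e ->
      (\sum_(0 <= k <oo) (cRe (inner mu (e k) (B (e k))))%:E < +oo)%E.

Definition has_trace A (t : R[i]) :=
  forall e, orthonormal_basis e ->
    cseries_cvg (fun k => inner mu (e k) (A (e k))) t.

End operators.

Section kernels.
Context d (T : measurableType d) (R : realType).
Variable mu : {measure set T -> \bar R}.
Implicit Types K B C : T * T -> R[i].

Definition kernel_operator K (f : T -> R[i]) : T -> R[i] :=
  fun x => cintegral mu (fun y => K (x, y) * f y).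

Definition kernel_product B C : T * T -> R[i] :=
  fun x => cintegral mu (fun z => B (x.1, z) * C (z, x.2)).

Definition kernel_dagger K : T * T -> R[i] := fun x => (K (x.2, x.1))^*.

End kernels.

Notation space3 R :=
  (measurableTypeR R * measurableTypeR R * measurableTypeR R)%type.
Notation config R N := (N.-tuple (space3 R)).

Section electrons.
Context (R : realType).

Definition leb2 : set (measurableTypeR R * measurableTypeR R) -> \bar R :=
  (@lebesgue_measure R \x @lebesgue_measure R)%E.
HB.instance Definition _ := Measure.on leb2.
HB.instance Definition _ := Measure_isSigmaFinite.Build _ _ _ leb2
  (sigma_finite_product (@lebesgue_measure R) (@lebesgue_measure R)).

Definition leb3 : set (space3 R) -> \bar R := (leb2 \x @lebesgue_measure R)%E.
HB.instance Definition _ := Measure.on leb3.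
HB.instance Definition _ := Measure_isSigmaFinite.Build _ _ _ leb3
  (sigma_finite_product leb2 (@lebesgue_measure R)).

Definition leb3x3 : set (space3 R * space3 R) -> \bar R := (leb3 \x leb3)%E.
HB.instance Definition _ := Measure.on leb3x3.
HB.instance Definition _ := Measure_isSigmaFinite.Build _ _ _ leb3x3
  (sigma_finite_product leb3 leb3).

Definition leb3N N : {sigma_finite_measure set (config R N) -> \bar R} :=
  tuple_measure leb3 N.

Definition permute N (s : 'S_N) (r : config R N) : config R N :=
  [tuple tnth r (s i) | i < N].

Definition totally_symmetric N (Psi : config R N -> R[i]) :=
  forall s : 'S_N, \forall r \ae leb3N N, Psi (permute s r) = Psi r.

Definition totally_antisymmetric N (Psi : config R N -> R[i]) :=
  forall s : 'S_N, \forall r \ae leb3N N,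
    Psi (permute s r) = (-1) ^+ s * Psi r.

(* A mixed state is carried by a decomposition into pure states; finite
   mixtures have eventually vanishing weights. *)
Record mixed_state N := MixedState {
  weight : nat -> R;
  pure : nat -> config R N -> R[i];
  weight_ge0 : forall i, 0 <= weight i;
  weight_sum1 : series weight @ \oo --> (1 : R);
  pure_L2 : forall i, L2 (leb3N N) (pure i);
  pure_normalized : forall i, sqL2norm (leb3N N) (pure i) = 1%E;
  pure_sym : forall i,
    totally_symmetric (pure i) \/ totally_antisymmetric (pure i) }.

(* The reduction integrates over the last N - 1 arguments, so N = n.+1. *)
Definition rdm1 n (Gamma : mixed_state n.+1) (x : space3 R * space3 R) : R[i] :=
  n.+1%:R * cseries (fun i => (weight Gamma i)%:C *
    cintegral (leb3N n) (fun t : config R n =>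
      pure Gamma i [tuple of x.1 :: t] * (pure Gamma i [tuple of x.2 :: t])^*)).

Definition density n (Gamma : mixed_state n.+1) (r : space3 R) : R[i] :=
  rdm1 Gamma (r, r).

Lemma densityE n (Gamma : mixed_state n.+1) (r : space3 R) :
  density Gamma r = n.+1%:R * cseries (fun i => (weight Gamma i *
    \int[leb3N n]_t Normc.normc (pure Gamma i [tuple of r :: t]) ^+ 2)%:C).
Proof.
rewrite /density /rdm1; congr (_ * cseries _); apply/funext => i.
rewrite rmorphM /=; congr (_ * _); rewrite /cintegral; congr Complex.
  apply: eq_Rintegral => t _ /=; case: (pure _ _ _) => a b /=.
  by rewrite sqr_sqrtr ?addr_ge0 ?sqr_ge0// mulrN opprK -!expr2.
have -> : (0 : R) = \int[leb3N n]_(t in setT) (0 : R).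
  by rewrite /Rintegral integral0.
apply: eq_Rintegral => t _ /=; case: (pure _ _ _) => a b /=.
by rewrite mulrN mulrC addrC subrr.
Qed.

Definition one_rdm_of N (D : space3 R * space3 R -> R[i]) :=
  [/\ L2 leb3x3 D,
      trace_class leb3 (kernel_operator leb3 D),
      \forall x \ae leb3x3, D x = kernel_dagger D x,
      forall phi, L2 leb3 phi ->
        0 <= cintegral leb3x3 (fun x => (phi x.1)^* * D x * phi x.2)
          <= 2 * (fine (sqL2norm leb3 phi))%:C
    & has_trace leb3 (kernel_operator leb3 D) N%:R].

Definition maps_to n (Gamma : mixed_state n.+1)
    (D : space3 R * space3 R -> R[i]) :=
  \forall x \ae leb3x3, rdm1 Gamma x = D x.

End electrons.

Arguments leb3 : clear implicits.
Arguments leb3x3 : clear implicits.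

(* Main.v *)
(* Both D_Gamma and G^dagger * G are Gram kernels K(r,s) = <F(r),F(s)>, where F
   maps space to an L^2 space.  A jointly measurable F is nearly constant on
   pieces: every set of positive measure contains one of positive measure on
   which F(r) varies by less than epsilon.  This is clear for indicators of
   rectangles and survives sums and limits, hence holds for indicators of
   measurable sets by the pi-lambda theorem, and then for all measurable F.
   On such a piece K(r,s) is close to K(r,r).  If two such kernels agree a.e.
   but their diagonals differ on a set of positive measure, shrink this set to
   a piece N' good for both: N' x N' has positive measure, so it contains a
   pair (r,s) where the kernels agree, which forces their values at (r,r) to be
   close, a contradiction. *)
Require Import Defs.
From mathcomp Require Import all_boot all_order all_algebra.
From mathcomp Require Import all_classical all_reals all_analysis.
From mathcomp Require Import measurable_realfun.
From mathcomp Require Import ring lra.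

Set Implicit Arguments.
Unset Strict Implicit.
Unset Printing Implicit Defensive.

Import Order.TTheory GRing.Theory Num.Theory.
Import numFieldNormedType.Exports.

Local Open Scope classical_set_scope.
Local Open Scope ring_scope.

(** * Functions of two points that become small on sets of positive measure *)

Section small_on_pieces.
Context d (X : measurableType d) (R : realType).
Variable mu : {measure set X -> \bar R}.
Implicit Types (E N : set X) (q : X -> X -> \bar R).

Lemma measure_gt0_bigcup N (F : (set X)^nat) :
  measurable N -> (forall k, measurable (F k)) -> N `<=` \bigcup_k F k ->
  (0 < mu N)%E -> exists k, (0 < mu (N `&` F k))%E.
Proof.
move=> mN mF NF; apply: contraPP => /forallNP F0.
have : mu.-negligible N.
  have -> : N = \bigcup_k (N `&` F k) by rewrite -setI_bigcupr setIidl.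
  apply: negligible_bigcup => k; apply/negligibleP; first exact: measurableI.
  by apply/eqP; rewrite -measure_le0 leNgt; apply/negP/F0.
by move/negligibleP => ->//; rewrite ltxx.
Qed.

(** A piece is found inside every [N] of positive measure, not only inside [E], so that pieces for
    several functions can be nested. The values are extended reals because [q] is typically an
    integral that may be infinite. *)
Definition small_on_pieces E q := forall N (e : R),
  measurable N -> N `<=` E -> (0 < mu N)%E -> 0 < e ->
  exists N', [/\ measurable N', N' `<=` N, (0 < mu N')%E &
    forall r s, N' r -> N' s -> (q r s <= e%:E)%E].

Lemma small_on_pieces_le E q q' :
  (forall r s, E r -> E s -> (q r s <= q' r s)%E) ->
  small_on_pieces E q' -> small_on_pieces E q.
Proof.
move=> qq' sq' N e mN NE N0 e0; have [N' [mN' N'N N'0 q'e]] := sq' N e mN NE N0 e0.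
exists N'; split=> // r s N'r N's.
by rewrite (le_trans (qq' _ _ _ _))//; [exact/NE/N'N|exact/NE/N'N|exact: q'e].
Qed.

Lemma small_on_pieces_sub E E' q :
  E' `<=` E -> small_on_pieces E q -> small_on_pieces E' q.
Proof. by move=> E'E sq N e mN NE'; apply: sq => //; exact: subset_trans E'E. Qed.

Lemma small_on_pieces0 E : small_on_pieces E (fun _ _ => 0%E).
Proof. by move=> N e mN _ N0 e0; exists N; split=> // *; rewrite lee_fin ltW. Qed.

(** The piece for [q'] is taken inside the piece for [q], and the bound for [q] survives the
    shrinking. *)
Lemma small_on_piecesD E q q' : small_on_pieces E q -> small_on_pieces E q' ->
  small_on_pieces E (fun r s => q r s + q' r s)%E.
Proof.
move=> sq sq' N e mN NE N0 e0; have e20 : 0 < e / 2 by rewrite divr_gt0.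
have [N1 [mN1 N1N N10 qe]] := sq N _ mN NE N0 e20.
have [N2 [mN2 N2N N20 q'e]] := sq' N1 _ mN1 (subset_trans N1N NE) N10 e20.
exists N2; split=> //; first exact: subset_trans N1N.
move=> r s N2r N2s; rewrite [e]splitr EFinD leeD//; last exact: q'e.
by apply: qe; exact: N2N.
Qed.

Lemma small_on_piecesZ E q (c : R) : 0 < c -> small_on_pieces E q ->
  small_on_pieces E (fun r s => c%:E * q r s)%E.
Proof.
move=> c0 sq N e mN NE N0 e0; have ec0 : 0 < c^-1 * e by rewrite mulr_gt0 ?invr_gt0.
have [N1 [mN1 N1N N10 qe]] := sq N _ mN NE N0 ec0.
exists N1; split=> // r s N1r N1s; rewrite -(mulVKf (lt0r_neq0 c0) e) EFinM.
by rewrite lee_pmul2l//; exact: qe.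
Qed.

Lemma small_on_pieces_sum E (q : nat -> X -> X -> \bar R) n :
  (forall i, small_on_pieces E (q i)) ->
  small_on_pieces E (fun r s => \sum_(0 <= i < n) q i r s)%E.
Proof.
move=> sq; elim: n => [|n IHn].
  apply: small_on_pieces_le (@small_on_pieces0 E) => r s _ _.
  by rewrite big_geq.
apply: small_on_pieces_le (small_on_piecesD IHn (sq n)) => r s _ _.
by rewrite big_nat_recr.
Qed.

(* The pieces of N are its parts on which some [b k] is small. *)
Lemma small_on_pieces_lim E q (p : nat -> X -> X -> \bar R)
    (b : nat -> X -> \bar R) :
  (forall k, measurable_fun setT (b k)) ->
  (forall r, E r -> b ^~ r @ \oo --> 0%E) ->
  (forall k, small_on_pieces E (p k)) ->
  (forall k r s, E r -> E s -> (q r s <= p k r s + (b k r + b k s))%E) ->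
  small_on_pieces E q.
Proof.
move=> mb b0 sp qpb N e mN NE N0 e0.
have e20 : 0 < e / 2 by rewrite divr_gt0.
have e40 : 0 < e / 2 / 2 by rewrite divr_gt0.
pose F k := b k @^-1` [set x | (x <= (e / 2 / 2)%:E)%E].
have mF k : measurable (F k).
  by rewrite -[F k]setTI; exact: emeasurable_fun_infty_c.
(* The sets [F k] cover [N] by pointwise convergence. Half of [e] is kept for [p k] and a quarter
   goes to each of [b k r] and [b k s]. *)
have [k N'0] : exists k, (0 < mu (N `&` F k))%E.
  apply: measure_gt0_bigcup => // r Nr.
  have e4 : (0 < (e / 2 / 2)%:E)%E by rewrite lte_fin.
  have [k _ bk] := b0 r (NE _ Nr) _ (open_ereal_lt' e4).
  by exists k => //; apply: ltW; exact: bk k (leqnn k).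
have mN' := measurableI _ _ mN (mF k).
have N'E : N `&` F k `<=` E by move=> r [/NE].
have [N2 [mN2 N2N N20 pe]] := sp k _ _ mN' N'E N'0 e20.
exists N2; split=> //; first by move=> r /N2N[].
move=> r s N2r N2s; have [Nr Fr] := N2N _ N2r; have [Ns Fs] := N2N _ N2s.
rewrite (le_trans (qpb k _ _ (NE _ Nr) (NE _ Ns)))// [e]splitr EFinD.
rewrite leeD//; first exact: pe.
by rewrite [e / 2]splitr EFinD leeD.
Qed.

End small_on_pieces.

(** * Oscillation of slices, and its stability under sums, multiples and limits *)

Section oscillation.
Context d d' (X : measurableType d) (W : measurableType d') (R : realType).
Variables (mu : {measure set X -> \bar R}).
Variables (nu : {sigma_finite_measure set W -> \bar R}).
Implicit Types (f g h : X * W -> R) (E : set X).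

Lemma measurable_slice d'' (Y : measurableType d'') (f : X * W -> Y) r :
  measurable_fun setT f -> measurable_fun setT (fun w => f (r, w)).
Proof. by move=> mf; apply: measurableT_comp mf _; exact: pair1_measurable. Qed.

Definition slice_norm2 f r := (\int[nu]_w (f (r, w) ^+ 2)%:E)%E.

(** The squared distance in L^2(nu) between the slices at [r] and [s], with infinity allowed. *)
Definition oscillation f r s := (\int[nu]_w ((f (r, w) - f (s, w)) ^+ 2)%:E)%E.

Lemma measurable_slice_norm2 f : measurable_fun setT f ->
  measurable_fun setT (slice_norm2 f).
Proof.
move=> mf.
apply: (@measurable_fun_fubini_tonelli_F _ _ _ _ _ nu (fun z => (f z ^+ 2)%:E)).
  by apply/measurable_EFinP; exact: measurable_funX.
by move=> z; rewrite lee_fin sqr_ge0.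
Qed.

Lemma le_slice_norm2 f g r : measurable_fun setT f -> measurable_fun setT g ->
  (forall w, `|f (r, w)| <= `|g (r, w)|) -> (slice_norm2 f r <= slice_norm2 g r)%E.
Proof.
move=> mf mg fg; apply: ge0_le_integral => //.
- by move=> w _; rewrite lee_fin sqr_ge0.
- by apply/measurable_EFinP/measurable_funX; exact: measurable_slice mf.
- by apply/measurable_EFinP/measurable_funX; exact: measurable_slice mg.
- by move=> w _; rewrite lee_fin -real_normK ?num_real// -[leRHS]real_normK
  ?num_real// lerXn2r ?nnegrE.
Qed.

Lemma measurable_sqr_diff f r s : measurable_fun setT f ->
  measurable_fun setT (fun w => ((f (r, w) - f (s, w)) ^+ 2)%:E).
Proof.
move=> mf; apply/measurable_EFinP/measurable_funX.
by apply: measurable_funB; exact: measurable_slice mf.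
Qed.

Definition oscillates_slowly E f :=
  measurable_fun setT f /\ small_on_pieces mu E (oscillation f).

(** Integrating (x + y)^2 <= 2 x^2 + 2 y^2 bounds the oscillation of the sum by twice those of the
    summands. *)
Lemma oscillates_slowlyD E f g : oscillates_slowly E f ->
  oscillates_slowly E g -> oscillates_slowly E (f \+ g).
Proof.
move=> [mf sf] [mg sg]; split; first exact: measurable_funD.
apply: (small_on_pieces_le _ (small_on_piecesD (small_on_piecesZ (ltr0n R 2) sf)
  (small_on_piecesZ (ltr0n R 2) sg))) => r s _ _.
rewrite -!ge0_integralZl_EFin//; try by [move=> w _;
  rewrite lee_fin sqr_ge0|exact: measurable_sqr_diff].
have m2 h : measurable_fun setT h ->
    measurable_fun setT (fun w => 2%:E * ((h (r, w) - h (s, w)) ^+ 2)%:E)%E.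
  by move=> mh; apply: measurable_funeM; exact: measurable_sqr_diff.
rewrite -ge0_integralD//; try by [move=> w _;
  rewrite -EFinM lee_fin mulr_ge0 ?sqr_ge0|exact: m2].
apply: ge0_le_integral => //.
- by move=> w _; rewrite lee_fin sqr_ge0.
- by apply: measurable_sqr_diff; exact: measurable_funD.
- by apply: emeasurable_funD; exact: m2.
- move=> w _; rewrite -!EFinM -EFinD lee_fin /=.
  by have := sqr_ge0 ((f (r, w) - f (s, w)) - (g (r, w) - g (s, w))); nra.
Qed.

Lemma oscillates_slowlyZ E (c : R) f : oscillates_slowly E f ->
  oscillates_slowly E (fun z => c * f z).
Proof.
move=> [mf sf]; split; first exact: measurable_funM.
(* The added 1 keeps the factor positive when [c] is 0. *)
have c0 : 0 < c ^+ 2 + 1 by rewrite ltr_wpDl ?sqr_ge0.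
apply: (small_on_pieces_le _ (small_on_piecesZ c0 sf)) => r s _ _.
rewrite -!ge0_integralZl_EFin//; try by [move=> w _;
  rewrite lee_fin sqr_ge0|exact: measurable_sqr_diff|exact: ltW].
apply: ge0_le_integral => //.
- by move=> w _; rewrite lee_fin sqr_ge0.
- by apply: (@measurable_sqr_diff (fun z => c * f z)); exact: measurable_funM.
- by apply: measurable_funeM; exact: measurable_sqr_diff.
- move=> w _; rewrite -EFinM lee_fin -mulrBr exprMn.
  by rewrite ler_wpM2r ?sqr_ge0// lerDl.
Qed.

Lemma oscillates_slowly_sum E (F : nat -> X * W -> R) n :
  (forall i, oscillates_slowly E (F i)) ->
  oscillates_slowly E (fun z => \sum_(i < n) F i z).
Proof.
move=> sF; elim: n => [|n IHn].
  under eq_fun do rewrite big_ord0.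
  split=> //; apply: small_on_pieces_le (@small_on_pieces0 _ _ _ mu E) => r s _ _.
  by rewrite /oscillation; under eq_integral do rewrite subrr expr0n/=;
    rewrite integral0.
under eq_fun do rewrite big_ord_recr/=.
exact: oscillates_slowlyD.
Qed.

(** On each slice over [E], [F k - f] tends to 0 in L^2 by dominated convergence with dominating
    function [g ^+ 2]. The oscillation of [f] is at most three times that of [F k] plus three times
    these errors at [r] and [s]. *)
Lemma oscillates_slowly_lim E f (F : nat -> X * W -> R) g :
  measurable_fun setT f -> measurable_fun setT g ->
  (forall k, oscillates_slowly E (F k)) ->
  (forall z, F ^~ z @ \oo --> f z) ->
  (forall k z, `|F k z - f z| <= g z) ->
  (forall r, E r -> (slice_norm2 g r < +oo)%E) ->
  oscillates_slowly E f.
Proof.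
move=> mf mg sF Ff Fg goo; split=> //.
have mF k := (sF k).1.
have mFf k : measurable_fun setT (F k \- f) by exact: measurable_funB.
have mD k r : measurable_fun setT (fun w => ((F k (r, w) - f (r, w)) ^+ 2)%:E).
  by apply/measurable_EFinP/measurable_funX; exact: (measurable_slice r (mFf k)).
apply: (@small_on_pieces_lim _ _ _ _ _ _
  (fun k r s => 3%:E * oscillation (F k) r s)%E
  (fun k r => 3%:E * slice_norm2 (F k \- f)%R r)%E).
- by move=> k; apply: measurable_funeM; exact: measurable_slice_norm2.
- move=> r Er; rewrite -[0%E](mule0 3%:E); apply: cvgeZl => //.
  have <- : (\int[nu]_w (cst 0 w) = 0 :> \bar R)%E by rewrite integral0.
  apply: (@dominated_cvg _ _ _ _ _ measurableT _ _
    (fun w => (g (r, w) ^+ 2)%:E)) => //.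
  + by move=> k; exact: mD.
  + move=> w _; apply: cvg_EFin; first exact: nearW.
    have Ff0 : F k (r, w) - f (r, w) @[k --> \oo] --> 0.
      by rewrite -(subrr (f (r, w))); apply: cvgB; [exact: Ff|exact: cvg_cst].
    have Ff2 := cvgM Ff0 Ff0; rewrite mulr0 in Ff2.
    exact: Ff2.
  + apply/integrableP; split.
      by apply/measurable_EFinP/measurable_funX; exact: measurable_slice mg.
    under eq_integral do rewrite gee0_abs ?lee_fin ?sqr_ge0//.
    exact: goo.
  + move=> k w _; rewrite gee0_abs ?lee_fin ?sqr_ge0//.
    rewrite -[leLHS]real_normK ?num_real// lerXn2r ?nnegrE//; last exact: Fg.
    exact: le_trans (Fg k (r, w)).
- by move=> k; apply: small_on_piecesZ => //; exact: (sF k).2.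
- move=> k r s _ _; rewrite -!ge0_integralZl_EFin//; try by [move=> w _;
  rewrite lee_fin sqr_ge0|exact: measurable_sqr_diff|exact: mD].
  have ge0 (x : R) : (0 <= 3%:E * (x ^+ 2)%:E)%E.
    by rewrite -EFinM lee_fin mulr_ge0 ?sqr_ge0.
  have m1 : measurable_fun setT
      (fun w => 3%:E * ((F k (r, w) - F k (s, w)) ^+ 2)%:E)%E.
    by apply: measurable_funeM; exact: measurable_sqr_diff.
  have m2 x : measurable_fun setT
      (fun w => 3%:E * ((F k (x, w) - f (x, w)) ^+ 2)%:E)%E.
    by apply: measurable_funeM; exact: mD.
  rewrite -ge0_integralD//; try by [exact: m2|move=> w _; exact: ge0].
  rewrite -ge0_integralD//; try by [apply: emeasurable_funD;
    exact: m2|move=> w _; exact: ge0|move=> w _; exact: adde_ge0].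
  apply: ge0_le_integral => //.
  + by move=> w _; rewrite lee_fin sqr_ge0.
  + exact: measurable_sqr_diff.
  + by apply: emeasurable_funD => //; apply: emeasurable_funD; exact: m2.
  + move=> w _; rewrite -!EFinM -!EFinD lee_fin /=.
    set a := F k (r, w); set b := F k (s, w); set a' := f (r, w);
      set b' := f (s, w).
    (* With x = a - b, y = a - a' and z = b - b' one has a' - b' = x - y + z, and these three
       squares add up to 3 (x^2 + y^2 + z^2) - (x - y + z)^2. *)
    have := sqr_ge0 ((a - b) + (a - a')).
    have := sqr_ge0 ((a - b) - (b - b')).
    have := sqr_ge0 ((a - a') + (b - b')).
    by nra.
Qed.

End oscillation.

(** * From rectangles to all measurable functions *)

Section oscillation_measurable.
Import HBNNSimple.
Context d d' (X : measurableType d) (W : measurableType d') (R : realType).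
Variables (mu : {measure set X -> \bar R}).
Variables (nu : {sigma_finite_measure set W -> \bar R}).
Implicit Types (f g h : X * W -> R) (E : set X).

Local Notation slow := (oscillates_slowly mu nu).

(** The slice at [r] is the indicator of [B] or 0, according to whether [r] lies in [A]. [N] meets
    [A] or its complement in positive measure, and the oscillation vanishes on that part. *)
Lemma oscillates_slowly_rect E (A : set X) (B : set W) :
  measurable A -> measurable B -> slow E \1_(A `*` B).
Proof.
move=> mA mB; split.
  by apply: measurable_indic; exact: measurableX.
move=> N e mN NE N0 e0.
have osc0 M : M `<=` A \/ M `<=` ~` A -> forall r s, M r -> M s ->
    (oscillation nu (\1_(A `*` B) : _ -> R) r s <= e%:E)%E.
  move=> MA r s Mr Ms; rewrite [X in (X <= _)%E](_ : _ = 0%E) ?lee_fin ?ltW//.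
  rewrite /oscillation; under eq_integral => w _.
    rewrite (_ : \1_(A `*` B) (r, w) = \1_(A `*` B) (s, w)) ?subrr ?expr0n/=.
    over.
    rewrite !indicE; congr (_%:R); congr nat_of_bool; apply/idP/idP;
      rewrite !inE/= => -[Ax Bw].
    - by split=> //; case: MA => MA; [exact: MA|have := MA _ Mr].
    - by split=> //; case: MA => MA; [exact: MA|have := MA _ Ms].
  by rewrite integral0.
pose F k := if k == 0%N then A else ~` A.
have [k kN0] : exists k, (0 < mu (N `&` F k))%E.
  apply: measure_gt0_bigcup => //.
    by move=> k; rewrite /F; case: ifP => // _; exact: measurableC.
  by move=> r _; have [Ar|nAr] := pselect (A r); [exists 0%N|exists 1%N].
exists (N `&` F k); split=> //.
  by apply: measurableI => //; rewrite /F; case: ifP => // _; exact: measurableC.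
by apply: osc0; rewrite /F; case: ifP => _; [left|right].
Qed.

(** The sets [C] with this property form a lambda-system containing the rectangles. Cutting off at a
    [B] of finite measure provides the square-integrable dominating function, the indicator of
    [setT]*[B], for increasing unions. *)
Lemma oscillates_slowly_indic (C : set (X * W)) (B : set W) :
  measurable C -> measurable B -> (nu B < +oo)%E ->
  slow setT \1_(C `&` (setT `*` B)).
Proof.
move=> mC mB Boo; have mTB : measurable ([set: X] `*` B) by exact: measurableX.
rewrite measurable_prod_measurableType in mC.
suff H : <<s [set A `*` A' | A in (@measurable _ X) & A' in (@measurable _ W)] >>
    `<=` [set C | measurable C /\ slow setT \1_(C `&` (setT `*` B))].
  by have [] := H _ mC.
apply: lambda_system_subset => //.
- move=> _ _ [A mA [A' mA' <-]] [K mK [K' mK' <-]].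
  by exists (A `&` K); [exact: measurableI|exists (A' `&` K');
    [exact: measurableI|rewrite setXI]].
- split => //.
  + by split=> //; rewrite setTI; exact: oscillates_slowly_rect.
  + move=> A K KA [mA sA] [mK sK]; split; first exact: measurableD.
    have -> : \1_((A `\` K) `&` (setT `*` B)) =
        \1_(A `&` (setT `*` B)) \+ (fun z => -1 * \1_(K `&` (setT `*` B)) z)
        :> (X * W -> R).
      apply/funext => z /=; rewrite !indicE.
      have : (z \in K) ==> (z \in A) by apply/implyP; rewrite !inE; exact: KA.
      move: ([set: X] `*` B) => D; rewrite in_setI in_setD !in_setI;
        case: (z \in D); case: (z \in K); case: (z \in A) => //= _;
        by rewrite ?mulN1r ?mulr0 ?subrr ?addr0 ?oppr0 ?addr0 ?subrr.
    by apply: oscillates_slowlyD => //; exact: oscillates_slowlyZ.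
  + move=> F ndF mF; have mUF : measurable (\bigcup_k F k).
      by apply: bigcupT_measurable => k; have [] := mF k.
    split=> //.
    have mU : measurable_fun setT
        (\1_((\bigcup_k F k) `&` (setT `*` B)) : X * W -> R).
      by apply: measurable_indic; exact: measurableI.
    apply: (@oscillates_slowly_lim _ _ _ _ _ _ _ _ _
      (fun k => \1_(F k `&` (setT `*` B))) (\1_(setT `*` B))) => //.
    * by move=> k; have [] := mF k.
    * move=> z; have [[k _ Fkz]|nFz] := pselect ((\bigcup_k F k) z).
        apply: cvg_near_cst; exists k => // m /= km; rewrite !indicE.
        congr (_%:R); congr nat_of_bool; apply/idP/idP; rewrite !inE => -[? ?];
          split=> //.
          by exists m.
        by move: Fkz; exact/subsetPset/ndF.
      apply: cvg_near_cst; apply: nearW => m; rewrite !indicE !memNset// => -[]//.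
      by move=> Fm; exfalso; apply: nFz; exists m.
    * move=> k z; rewrite !indicE; have [Bz|nBz] := pselect ((setT `*` B) z).
        rewrite [(z \in setT `*` B)]mem_set//.
        by do 2 case: (_ \in _); rewrite /= ?subrr ?subr0 ?sub0r ?normrN ?normr1
          ?normr0.
      by rewrite !memNset ?subrr ?normr0// => -[].
    * move=> r _; rewrite /slice_norm2.
      rewrite [X in (X < _)%E](_ : _ = nu B)//.
      under eq_integral => w _.
        rewrite (_ : \1_(setT `*` B) (r, w) ^+ 2 = \1_B w).
        over.
        rewrite !indicE -natrX; congr (_%:R).
        rewrite (_ : ((r, w) \in [set: X] `*` B) = (w \in B));
          first by case: (w \in B).
        by apply/idP/idP; rewrite !inE; [case|split].
      by rewrite integral_indic// setIT.
- move=> _ [A mA [A' mA' <-]]; split; first exact: measurableX.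
  rewrite /= -setXI setIT; apply: oscillates_slowly_rect => //; exact: measurableI.
Qed.

Lemma oscillates_slowly_sub E E' f : E' `<=` E -> slow E f -> slow E' f.
Proof. by move=> E'E [mf sf]; split=> //; exact: small_on_pieces_sub sf. Qed.

Lemma oscillates_slowly_nnsfun (g : {nnsfun X * W >-> R}) (B : set W) :
  measurable B -> (nu B < +oo)%E ->
  slow setT (fun z => g z * \1_(setT `*` B) z).
Proof.
move=> mB Boo.
(* The values of [g] are listed as a sequence over all of [nat], with default 0 past the end, as the
   lemma on sums expects. *)
set c := fun i => (finmap.enum_fset (fset_set (range g)))`_i.
have -> : (fun z => g z * \1_(setT `*` B) z) =
    fun z => \sum_(i < size (finmap.enum_fset (fset_set (range g))))
      c i * \1_((g @^-1` [set c i]) `&` (setT `*` B)) z.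
  apply/funext => z; rewrite {1}fimfunEord mulr_suml; apply: eq_bigr => i _.
  by rewrite -mulrA indicI.
apply: (oscillates_slowly_sum
  (F := fun i z => c i * \1_((g @^-1` [set c i]) `&` (setT `*` B)) z)) => i.
apply: oscillates_slowlyZ; apply: oscillates_slowly_indic => //.
Qed.

(** Simple functions increasing to [f] are cut off at sets [B k] of finite measure that exhaust [W].
    These approximations lie between 0 and [f], so [f] itself dominates the errors, and its slices
    have finite norm on the chosen set. *)
Lemma oscillates_slowly_ge0 f : measurable_fun setT f -> (forall z, 0 <= f z) ->
  slow [set r | (slice_norm2 nu f r < +oo)%E] f.
Proof.
move=> mf f0; have mf' : measurable_fun setT (EFin \o f) by exact/measurable_EFinP.
have /sigma_finiteP[B [TB ndB mB]] := sigma_finiteT nu.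
pose g := nnsfun_approx measurableT mf'.
have g_cvg z : g ^~ z @ \oo --> f z.
  by have /fine_cvgP[] :=
    cvg_nnsfun_approx measurableT mf' (fun z _ => f0 z) (I : setT z).
have g_le k z : g k z <= f z.
  rewrite -(cvg_lim _ (g_cvg z))//.
  apply: (@nondecreasing_cvgn_le _ (g ^~ z)); last by apply/cvg_ex; exists (f z);
    exact: g_cvg.
  by move=> m n mn; exact/lefP/nd_nnsfun_approx.
apply: (@oscillates_slowly_lim _ _ _ _ _ _ _ _ _
    (fun k z => g k z * \1_(setT `*` B k) z) f) => //.
- move=> k; have [mBk Bkoo] := mB k.
  by apply: oscillates_slowly_sub (oscillates_slowly_nnsfun _ mBk Bkoo).
- move=> z; have [k _ Bkz] : (\bigcup_k B k) z.2 by rewrite -TB.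
  apply: cvg_trans (g_cvg z); apply: near_eq_cvg; exists k => // m /= km.
  rewrite indicE mem_set ?mulr1//=; split=> //.
  by move: Bkz; exact/subsetPset/ndB.
- move=> k z; rewrite indicE ler_norml; have : 0 <= g k z by [];
  have := g_le k z; have := f0 z.
  by case: (_ \in _) => /=; rewrite ?mulr1 ?mulr0 => *; apply/andP; split; lra.
Qed.

(** The positive and negative parts are dominated by the absolute value of [f], so their slices have
    finite norm wherever those of [f] do. *)
Lemma oscillates_slowly_measurable f : measurable_fun setT f ->
  slow [set r | (slice_norm2 nu f r < +oo)%E] f.
Proof.
move=> mf; have mfp := measurable_funrpos mf; have mfn := measurable_funrneg mf.
rewrite [X in slow _ X](_ : f = f^\+ \+ (fun z => -1 * f^\- z)); last first.
  by rewrite -[LHS]funrposBneg; apply/funext => z /=; rewrite mulN1r.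
have le_norm z : `|f^\+ z| <= `|f z| /\ `|f^\- z| <= `|f z|.
  rewrite (ger0_norm (funrpos_ge0 f z)) (ger0_norm (funrneg_ge0 f z)).
  have <- : (f^\+ \+ f^\-) z = `|f z|.
    by rewrite [LHS](congr1 (@^~ z) (funrposDneg f)).
  by rewrite lerDl lerDr; split; [exact: funrneg_ge0|exact: funrpos_ge0].
apply: oscillates_slowlyD; last apply: oscillates_slowlyZ.
- apply: (oscillates_slowly_sub _ (oscillates_slowly_ge0 mfp _)) => //.
  by move=> r /=; apply: le_lt_trans; apply: le_slice_norm2 => // w;
    have [] := le_norm (r, w).
- apply: (oscillates_slowly_sub _ (oscillates_slowly_ge0 mfn _)) => //.
  by move=> r /=; apply: le_lt_trans; apply: le_slice_norm2 => // w;
    have [] := le_norm (r, w).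
Qed.

End oscillation_measurable.

(** * Absolutely convergent series *)

Section series_norm.
Variable R : realType.
Implicit Types u : R^nat.

Lemma normr_nneseries_cvg u : (\sum_(0 <= i <oo) `|u i|%:E < +oo)%E ->
  cvgn (series u) /\ (`|limn (series u)|%:E <= \sum_(0 <= i <oo) `|u i|%:E)%E.
Proof.
set S := (\sum_(0 <= i <oo) _)%E => Soo.
have S0 : (0 <= S)%E by apply: nneseries_ge0 => i _ _; rewrite lee_fin.
have leS n : [normed series u] n <= fine S.
  rewrite -lee_fin fineK ?ge0_fin_numE// /series /= -sumEFin.
  by apply: nneseries_lim_ge => i _; rewrite lee_fin.
have cu : cvgn [normed series u].
  apply: nondecreasing_is_cvgn.
    by apply: nondecreasing_series => i _ _ /=.
  by exists (fine S) => _ [n _ <-].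
split; first exact: normed_cvg.
rewrite -(@fineK _ S) ?ge0_fin_numE// lee_fin (le_trans (lim_series_norm cu))//.
by apply: limr_le => //; exact: nearW.
Qed.

Lemma measurable_nneseries_from d (X : measurableType d)
    (h : nat -> X -> \bar R) m :
  (forall i r, 0 <= h i r)%E -> (forall i, measurable_fun setT (h i)) ->
  measurable_fun setT (fun r => \sum_(m <= i <oo) h i r)%E.
Proof.
move=> h0 mh.
(* The starting index becomes a filter on the indices, which gives measurability of tails. *)
have -> : (fun r => \sum_(m <= i <oo) h i r)%E =
    (fun r => \sum_(i <oo | i \in [pred j | (m <= j)%N]) h i r)%E.
  by apply/funext => r; rewrite eseries_cond.
exact: ge0_emeasurable_sum.
Qed.

End series_norm.

(** * Real parts of complex products *)

Section complex_modulus.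
Variable R : realType.
Local Notation cRe := (@complex.Re R).
Local Notation cIm := (@complex.Im R).

Lemma sqr_normc (z : R[i]) : Normc.normc z ^+ 2 = cRe z ^+ 2 + cIm z ^+ 2.
Proof. by case: z => a b; rewrite /= sqr_sqrtr// addr_ge0 ?sqr_ge0. Qed.

Lemma Re_mul_conj (z w : R[i]) : cRe (z * w^*) = cRe z * cRe w + cIm z * cIm w.
Proof. by case: z w => a b [c e]; rewrite /= mulrN opprK. Qed.

Lemma normr_Re_mul_conj_le (z w : R[i]) :
  `|cRe (z * w^*)| <= Normc.normc z ^+ 2 + Normc.normc w ^+ 2.
Proof.
rewrite !sqr_normc Re_mul_conj ler_norml.
move: (cRe z) (cIm z) (cRe w) (cIm w) => p q p' q'.
have := sqr_ge0 (p + p'); have := sqr_ge0 (p - p').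
have := sqr_ge0 (q + q'); have := sqr_ge0 (q - q').
by move=> *; apply/andP; split; nra.
Qed.

Lemma measurable_sqr_normc d (T : measurableType d) (f : T -> R[i]) :
  cmeasurable f -> measurable_fun setT (fun z => (Normc.normc (f z) ^+ 2)%:E).
Proof.
move=> [mr mi]; under eq_fun do rewrite sqr_normc.
by apply/measurable_EFinP; apply: measurable_funD; exact: measurable_funX.
Qed.

End complex_modulus.

(** * Gram kernels of slices *)

Section gram.
Context d d' (X : measurableType d) (W : measurableType d') (R : realType).
Variables (mu : {measure set X -> \bar R}).
Variables (nu : {sigma_finite_measure set W -> \bar R}).
Implicit Types (f : X * W -> R[i]).
Local Notation cRe := (@complex.Re R).
Local Notation cIm := (@complex.Im R).

(** The real part of the inner product of two slices. It carries all the information on the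
    diagonal, where the inner product is real. *)
Definition gram f r s : R := \int[nu]_w cRe (f (r, w) * (f (s, w))^*).

Definition slice_sqL2norm f r : \bar R := sqL2norm nu (fun w => f (r, w)).

Lemma gram_diag f r : gram f r r = fine (slice_sqL2norm f r).
Proof.
rewrite /gram /Rintegral; congr fine; apply: eq_integral => w _.
by rewrite Re_mul_conj sqr_normc !expr2.
Qed.

Lemma slice_sqL2norm_ge0 f r : (0 <= slice_sqL2norm f r)%E.
Proof. by apply: integral_ge0 => w _; rewrite lee_fin sqr_ge0. Qed.

(** The real-valued integral is [fine] of the extended one, and [fine] never increases the absolute
    value since it sends infinities to 0. *)
Lemma normr_Rintegral_le (h : W -> R) : measurable_fun setT h ->
  (`|\int[nu]_w h w|%:E <= \int[nu]_w `|h w|%:E)%E.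
Proof.
move=> mh; have mEh : measurable_fun setT (EFin \o h) by exact/measurable_EFinP.
apply: (le_trans _ (le_abse_integral nu measurableT mEh)).
have norm_fine (x : \bar R) : (`|fine x|%:E <= `|x|)%E.
  by case: x => [x||]; rewrite /= ?normr0 ?leey.
exact: norm_fine.
Qed.

Section measurable_gram.
Variable f : X * W -> R[i].
Hypothesis mf : cmeasurable f.

Let a := cRe \o f.
Let b := cIm \o f.
Let ma : measurable_fun setT a. Proof. by case: mf. Qed.
Let mb : measurable_fun setT b. Proof. by case: mf. Qed.

Let mas r : measurable_fun setT (fun w => a (r, w)).
Proof. exact: measurable_slice ma. Qed.
Let mbs r : measurable_fun setT (fun w => b (r, w)).
Proof. exact: measurable_slice mb. Qed.

Lemma measurable_slice_sqL2norm : measurable_fun setT (slice_sqL2norm f).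
Proof.
apply: (@measurable_fun_fubini_tonelli_F _ _ _ _ _ nu
  (fun z => (Normc.normc (f z) ^+ 2)%:E)).
  exact: measurable_sqr_normc.
by move=> z; rewrite lee_fin sqr_ge0.
Qed.

Lemma measurable_gram_diag : measurable_fun setT (fun r => gram f r r).
Proof.
under eq_fun do rewrite gram_diag.
apply: measurableT_comp; first exact: fine_measurable.
exact: measurable_slice_sqL2norm.
Qed.

Lemma integral_slice_sqL2norm (m : {sigma_finite_measure set X -> \bar R}) :
  (\int[m]_r slice_sqL2norm f r = sqL2norm (m \x nu)%E f)%E.
Proof.
rewrite /sqL2norm (@fubini_tonelli1 _ _ _ _ _ m nu)//.
  exact: measurable_sqr_normc.
by move=> z; rewrite lee_fin sqr_ge0.
Qed.

Let mnorm r : measurable_fun setT (fun w => (Normc.normc (f (r, w)) ^+ 2)%:E).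
Proof. exact: measurable_slice (measurable_sqr_normc mf). Qed.

Lemma measurable_gram_integrand r s :
  measurable_fun setT (fun w => cRe (f (r, w) * (f (s, w))^*)).
Proof.
under eq_fun do rewrite Re_mul_conj.
by apply: measurable_funD; apply: measurable_funM; by [exact: mas|exact: mbs].
Qed.

Lemma normr_gram_le r s :
  (`|gram f r s|%:E <= slice_sqL2norm f r + slice_sqL2norm f s)%E.
Proof.
apply: le_trans (normr_Rintegral_le (measurable_gram_integrand r s)) _.
rewrite -ge0_integralD//; try by move=> w _; rewrite lee_fin sqr_ge0.
apply: ge0_le_integral => //.
- by apply/measurable_EFinP/measurableT_comp => //;
  exact: measurable_gram_integrand.
- by apply: emeasurable_funD; exact: mnorm.
- move=> w _; rewrite -EFinD lee_fin; exact: normr_Re_mul_conj_le.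
Qed.

Lemma integrable_gram r s :
  (slice_sqL2norm f r < +oo)%E -> (slice_sqL2norm f s < +oo)%E ->
  nu.-integrable setT (EFin \o (fun w => cRe (f (r, w) * (f (s, w))^*))).
Proof.
move=> roo soo; apply/integrableP; split.
  by apply/measurable_EFinP; exact: measurable_gram_integrand.
apply: (@le_lt_trans _ _ (slice_sqL2norm f r + slice_sqL2norm f s)%E);
  last exact: lte_add_pinfty.
rewrite -ge0_integralD//; try by move=> w _; rewrite lee_fin sqr_ge0.
apply: ge0_le_integral => //.
- by apply: measurableT_comp => //; apply/measurable_EFinP;
  exact: measurable_gram_integrand.
- by apply: emeasurable_funD; exact: mnorm.
- move=> w _; rewrite -EFinD /= lee_fin; exact: normr_Re_mul_conj_le.
Qed.

(** The left side is the real part of the inner product of F(r) with F(r) - F(s), where F(r) is the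
    slice at [r]. A weighted Young inequality replaces Cauchy-Schwarz: the norm term vanishes as [k]
    grows, and for fixed [k] the oscillations are small on pieces. *)
Lemma normr_gramB_le (k : nat) r s :
  (slice_sqL2norm f r < +oo)%E -> (slice_sqL2norm f s < +oo)%E ->
  (`|gram f r r - gram f r s|%:E <=
    (k.+1%:R)%:E * (oscillation nu a r s + oscillation nu b r s) +
    (k.+1%:R^-1)%:E * slice_sqL2norm f r)%E.
Proof.
move=> roo soo; rewrite /gram -RintegralB//; try exact: integrable_gram.
have mI : measurable_fun setT
    (fun w => cRe (f (r, w) * (f (r, w))^*) - cRe (f (r, w) * (f (s, w))^*)).
  by apply: measurable_funB; exact: measurable_gram_integrand.
apply: le_trans (normr_Rintegral_le mI) _.
have sq0 (x : R) : (0 <= (x ^+ 2)%:E)%E by rewrite lee_fin sqr_ge0.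
have mo (g : X * W -> R) : measurable_fun setT g ->
  measurable_fun setT (fun w => ((g (r, w) - g (s, w)) ^+ 2)%:E).
  exact: measurable_sqr_diff.
rewrite -ge0_integralD//; try by [exact: mo|move=> w _; exact: sq0].
have mo2 : measurable_fun setT (fun w =>
    ((a (r, w) - a (s, w)) ^+ 2)%:E + ((b (r, w) - b (s, w)) ^+ 2)%:E)%E.
  by apply: emeasurable_funD; exact: mo.
have k0 : 0 < k.+1%:R :> R by rewrite ltr0n.
have kV0 : 0 < k.+1%:R^-1 :> R by rewrite invr_gt0.
rewrite -ge0_integralZl_EFin//.
rewrite -ge0_integralZl_EFin//.
rewrite -ge0_integralD//.
- apply: ge0_le_integral => //.
  + by apply/measurable_EFinP/measurableT_comp.
  + by apply: emeasurable_funD; exact: measurable_funeM.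
  + move=> w _; rewrite -!EFinD lee_fin sqr_normc !Re_mul_conj /a /b /=.
    move: (cRe (f (r, w))) (cIm (f (r, w))) => p q.
    move: (cRe (f (s, w))) (cIm (f (s, w))) => p' q'.
    have amgm (x y : R) : `|x * y| <= k.+1%:R * y ^+ 2 + k.+1%:R^-1 * x ^+ 2.
      move: kV0; set c : R := k.+1%:R; set e := c^-1 => e0.
      have ce : c * e = 1 by rewrite divff// lt0r_neq0.
      (* Expanding both squares gives 2 |x y| <= c y^2 + c^-1 x^2, which is stronger than the
         claim. *)
      have := mulr_ge0 (ltW e0) (sqr_ge0 (x - c * y)).
      have := mulr_ge0 (ltW e0) (sqr_ge0 (x + c * y)).
      have -> : e * (x + c * y) ^+ 2 =
          e * x ^+ 2 + (c * e) * (2 * x * y) + (c * e) * c * y ^+ 2 by ring.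
      have -> : e * (x - c * y) ^+ 2 =
          e * x ^+ 2 - (c * e) * (2 * x * y) + (c * e) * c * y ^+ 2 by ring.
      rewrite ce ler_norml => h1 h2; apply/andP; split; nra.
    rewrite (_ : _ - _ = p * (p - p') + q * (q - q')); last by ring.
    rewrite (le_trans (ler_normD _ _))// (le_trans (lerD (amgm _ _) (amgm _ _)))//.
    by rewrite le_eqVlt; apply/orP; left; apply/eqP; ring.
- by move=> w _; rewrite mule_ge0 ?adde_ge0// lee_fin ltW.
- exact: measurable_funeM.
- by move=> w _; rewrite mule_ge0// lee_fin ltW.
- exact: measurable_funeM.
- by move=> w _; exact: adde_ge0.
Qed.

Lemma small_gramB : small_on_pieces mu [set r | (slice_sqL2norm f r < +oo)%E]
  (fun r s => `|gram f r r - gram f r s|%:E).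
Proof.
set E := [set r | _].
apply: (@small_on_pieces_lim _ _ _ _ _ _
  (fun k r s => (k.+1%:R)%:E * (oscillation nu a r s + oscillation nu b r s))%E
  (fun k r => (k.+1%:R^-1)%:E * slice_sqL2norm f r)%E).
- by move=> k; apply: measurable_funeM; exact: measurable_slice_sqL2norm.
- move=> r Er; have nf : slice_sqL2norm f r \is a fin_num.
    by rewrite ge0_fin_numE ?slice_sqL2norm_ge0.
  rewrite -(fineK nf); apply: cvg_EFin; first exact: nearW.
  rewrite -(mul0r (fine (slice_sqL2norm f r))).
  have h := cvgM (@cvg_harmonic R) (cvg_cst (fine (slice_sqL2norm f r))).
  exact: h.
- move=> k; apply: small_on_piecesZ; first by rewrite ltr0n.
  (* Real and imaginary parts are bounded by the modulus, so on [E] their slices have finite norm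
     and they oscillate slowly there. *)
  have le_ab (g : X * W -> R) : measurable_fun setT g ->
      (forall z, `|g z| <= `|Normc.normc (f z)|) ->
      small_on_pieces mu E (oscillation nu g).
    move=> mg gf; have [_] := oscillates_slowly_measurable mu nu mg.
    apply: small_on_pieces_sub => r /=; apply: le_lt_trans.
    apply: ge0_le_integral => //.
    + by move=> w _; rewrite lee_fin sqr_ge0.
    + by apply/measurable_EFinP/measurable_funX; exact: measurable_slice mg.
    + move=> w _; rewrite lee_fin -real_normK ?num_real// -[leRHS]real_normK
      ?num_real//.
      by rewrite lerXn2r ?nnegrE.
  have norm_le (x y : R) : x ^+ 2 <= y ^+ 2 -> `|x| <= `|y|.
    by rewrite -(real_normK (num_real x)) -(real_normK (num_real y)) ler_pXn2r
      ?nnegrE.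
  apply: small_on_piecesD; apply: le_ab => // z; apply: norm_le; rewrite sqr_normc.
    by rewrite lerDl sqr_ge0.
  by rewrite lerDr sqr_ge0.
- move=> k r s Er Es; apply: le_trans (normr_gramB_le k Er Es) _.
  by apply: leeD2l; rewrite leeDl// mule_ge0 ?slice_sqL2norm_ge0// lee_fin invr_ge0.
Qed.

End measurable_gram.
End gram.

(** * Weighted series of Gram kernels *)

Section gram_series.
Context d d' (X : measurableType d) (W : measurableType d') (R : realType).
Variables (mu : {measure set X -> \bar R}).
Variables (nu : {sigma_finite_measure set W -> \bar R}).
Variables (p : nat -> R) (f : nat -> X * W -> R[i]).
Hypothesis p0 : forall i, 0 <= p i.
Hypothesis mf : forall i, cmeasurable (f i).

Definition gram_series r s : R := limn (series (fun i => p i * gram nu (f i) r s)).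

(** The squared norm of the sequence of slices at [r] in the [p]-weighted direct sum of copies of
    L^2(nu). Where it is finite at both [r] and [s], the Gram series converges absolutely. *)
Definition slice_norm_series r : \bar R :=
  (\sum_(0 <= i <oo) (p i)%:E * slice_sqL2norm nu (f i) r)%E.

Let h i r := ((p i)%:E * slice_sqL2norm nu (f i) r)%E.
Let E := [set r | (slice_norm_series r < +oo)%E].

Let h_ge0 i r : (0 <= h i r)%E.
Proof. by rewrite mule_ge0 ?lee_fin ?slice_sqL2norm_ge0. Qed.

Let mh i : measurable_fun setT (h i).
Proof. by apply: measurable_funeM; exact: measurable_slice_sqL2norm. Qed.

Lemma measurable_slice_norm_series : measurable_fun setT slice_norm_series.
Proof. exact: measurable_nneseries_from. Qed.

Let h_fin i r : E r -> h i r \is a fin_num.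
Proof.
move=> Er; rewrite ge0_fin_numE//; apply: le_lt_trans Er.
apply: (le_trans _ (nneseries_lim_ge i.+1 _)); last by move=> j _ _; exact: h_ge0.
by rewrite big_nat_recr//=; apply: leeDr; apply: sume_ge0 => j _; exact: h_ge0.
Qed.

Let term_le i r s : (`|p i * gram nu (f i) r s|%:E <= h i r + h i s)%E.
Proof.
rewrite normrM ger0_norm// EFinM -ge0_muleDr ?slice_sqL2norm_ge0//.
by apply: lee_wpmul2l; [rewrite lee_fin|exact: normr_gram_le].
Qed.

Let cvg_gram_series r s : E r -> E s ->
  cvgn (series (fun i => p i * gram nu (f i) r s)).
Proof.
move=> Er Es; apply: (proj1 (normr_nneseries_cvg _)).
apply: (@le_lt_trans _ _ (slice_norm_series r + slice_norm_series s)%E);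
  last exact: lte_add_pinfty.
rewrite -nneseriesD; try by move=> i _ _; exact: h_ge0.
by apply: lee_nneseries => // i _; exact: term_le.
Qed.

Lemma measurable_gram_series_diag : measurable_fun E (fun r => gram_series r r).
Proof.
apply: (@measurable_fun_cvg _ _ _ _
  (fun n r => series (fun i => p i * gram nu (f i) r r) n)).
  move=> n; rewrite /series/=; apply: measurable_sum => i.
  by apply: measurable_funM => //; apply: measurable_funTS;
    exact: measurable_gram_diag.
by move=> r Er; have := cvg_gram_series Er Er.
Qed.

(** The series is cut at [m]. The head is a finite sum of terms that are small on pieces, and the
    rest is bounded by tails of [slice_norm_series], which tend to 0 at each point of [E]. *)
Lemma small_gram_seriesB :
  small_on_pieces mu E (fun r s => `|gram_series r r - gram_series r s|%:E).
Proof.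
pose w r s i := p i * gram nu (f i) r r - p i * gram nu (f i) r s.
pose t m r := (\sum_(m <= i <oo) h i r)%E.
have t_ge0 m r : (0 <= t m r)%E by apply: nneseries_ge0.
apply: (@small_on_pieces_lim _ _ _ _ _ _
  (fun m r s => \sum_(0 <= i < m) `|w r s i|%:E)%E
  (fun m r => 3%:E * t m r)%E).
- by move=> m; apply: measurable_funeM; exact: measurable_nneseries_from.
- move=> r Er; rewrite -[0%E](mule0 3%:E); apply: cvgeZl => //.
  exact: nneseries_tail_cvg.
- move=> m; apply: small_on_pieces_sum => i.
  (* A zero weight is treated apart: then membership in [E] says nothing about the slices of [f i],
     whose norm may be infinite. *)
  have [pi0|pi0] := eqVneq (p i) 0.
    apply: small_on_pieces_le (@small_on_pieces0 _ _ _ mu E) => r s _ _.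
    by rewrite /w pi0 !mul0r subrr normr0.
  have pi_gt0 : 0 < p i by rewrite lt_neqAle eq_sym pi0 p0.
  have subE : E `<=` [set r | (slice_sqL2norm nu (f i) r < +oo)%E].
    move=> r Er /=; have := h_fin i Er; rewrite /h.
    have := slice_sqL2norm_ge0 nu (f i) r.
    case: (slice_sqL2norm nu (f i) r) => [x||] //=; first by rewrite ltry.
    by rewrite mulry gtr0_sg// mul1e.
  have sp := small_on_pieces_sub subE
    (small_on_piecesZ pi_gt0 (@small_gramB _ _ _ _ _ mu nu _ (mf i))).
  apply: small_on_pieces_le sp => r s _ _.
  by rewrite /w -mulrBr normrM ger0_norm// EFinM.
- move=> m r s Er Es.
  (* The diagonal term is at most 2 h(r) and the other at most h(r) + h(s), whence the factor 3. *)
  have w_le i : (`|w r s i|%:E <= 3%:E * (h i r + h i s))%E.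
    have := term_le i r r; have := term_le i r s; rewrite /w.
    have := h_ge0 i r; have := h_ge0 i s.
    rewrite -(fineK (h_fin i Er)) -(fineK (h_fin i Es)) -!EFinD -EFinM !lee_fin.
    move=> ? ? h1 h2; rewrite (le_trans (ler_normB _ _))//; lra.
  have tail_le k :
      (\sum_(k <= i <oo) `|w r s i|%:E <= 3%:E * t k r + 3%:E * t k s)%E.
    rewrite -ge0_muleDr// -nneseriesD// -nneseriesZl//; last by move=> i _;
      rewrite adde_ge0.
    exact: lee_nneseries.
  have -> : gram_series r r - gram_series r s = limn (series (w r s)).
    rewrite -limB; [|exact: cvg_gram_series..].
    by congr (limn _); apply/funext => n; rewrite /series /= sumrB.
  apply: le_trans (proj2 (normr_nneseries_cvg _)) _.
    apply: le_lt_trans (tail_le 0%N) _.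
    by rewrite lte_add_pinfty// lte_mul_pinfty.
  rewrite (nneseries_split 0 m)//.
  by rewrite add0n; apply: leeD => //; exact: tail_le.
Qed.

End gram_series.

(** * Uniqueness of the diagonal *)

Section diagonal.
Context d (X : measurableType d) (R : realType).
Variable mu : {sigma_finite_measure set X -> \bar R}.

(* Two kernels agreeing almost everywhere agree somewhere on any square of
   positive measure, here one where both are close to their diagonal values. *)
Lemma diag_unique (E : set X) (k1 k2 : X -> X -> R) :
  measurable E ->
  measurable_fun E (fun r => k1 r r) -> measurable_fun E (fun r => k2 r r) ->
  small_on_pieces mu E (fun r s => `|k1 r r - k1 r s|%:E) ->
  small_on_pieces mu E (fun r s => `|k2 r r - k2 r s|%:E) ->
  (mu \x mu)%E.-negligible [set z | k1 z.1 z.2 <> k2 z.1 z.2] ->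
  mu.-negligible [set r | E r /\ k1 r r <> k2 r r].
Proof.
move=> mE mk1 mk2 sk1 sk2 [Z [mZ Z0 subZ]].
pose gap r := `|k1 r r - k2 r r|.
have mgap : measurable_fun E gap by apply: measurableT_comp => //;
  exact: measurable_funB.
(* The exceptional set is the countable union of the sets where the gap exceeds 1/(k+1), so it is
   enough that each of these is null. *)
pose F k := E `&` gap @^-1` [set` `]k.+1%:R^-1, +oo[].
have mF k : measurable (F k) by exact: mgap.
have -> : [set r | E r /\ k1 r r <> k2 r r] = \bigcup_k F k.
  apply/seteqP; split=> r /=.
    move=> [Er /eqP]; rewrite -subr_eq0 -normr_gt0 => gap0.
    have [k kgap] := ltr_add_invr gap0.
    exists k => //; split=> //=; rewrite in_itv/= andbT.
    by rewrite add0r in kgap.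
  move=> [k _ [Er]] /=; rewrite in_itv/= andbT => gapk; split=> // k12.
  by move: gapk; rewrite /gap k12 subrr normr0 ltNge invr_ge0 ler0n.
apply: negligible_bigcup => k; apply/negligibleP => //.
apply/eqP; rewrite -measure_le0 leNgt; apply/negP => Fk0.
(* Each kernel may vary by half of the gap; the total 1/(k+1) then contradicts the strict bound
   defining [F k]. *)
have e0 : 0 < k.+1%:R^-1 / 2 :> R by rewrite divr_gt0// invr_gt0.
have [N1 [mN1 N1F N10 k1e]] := sk1 _ _ (mF k) (@subIsetl _ _ _) Fk0 e0.
have N1E : N1 `<=` E by move=> r /N1F[].
have [N2 [mN2 N2N N20 k2e]] := sk2 _ _ mN1 N1E N10 e0.
have [[r s] [N2r N2s] k12] : exists2 z, (N2 `*` N2) z & k1 z.1 z.2 = k2 z.1 z.2.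
  apply: contrapT => /forall2NP N2k.
  have : ((mu \x mu) (N2 `*` N2) <= 0)%E.
    rewrite -Z0; apply: le_measure; rewrite ?inE//; first exact: measurableX.
    by move=> z N2z; apply: subZ => /=; have [] := N2k z.
  by rewrite product_measure1E// leNgt mule_gt0.
have [_ /=] := N1F _ (N2N _ N2r); rewrite in_itv/= andbT /gap.
have := k1e _ _ (N2N _ N2r) (N2N _ N2s); have := k2e _ _ N2r N2s.
rewrite !lee_fin /= -k12 => h2 h1; apply/negP; rewrite -leNgt.
rewrite (_ : _ - _ = (k1 r r - k1 r s) - (k2 r r - k1 r s)); last by ring.
by rewrite (le_trans (ler_normB _ _))// [leRHS]splitr lerD.
Qed.

End diagonal.

(** * Norms and measurability for electronic wave functions *)

Section electron_kernels.
Variable R : realType.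
Local Notation cRe := (@complex.Re R).
Local Notation cIm := (@complex.Im R).

(** Change of variables: the measure on tuples is the image of the product measure, so the first
    argument can be split off. *)
Lemma sqL2norm_cons_measure d (T : measurableType d)
    (m : {sigma_finite_measure set T -> \bar R}) n
    (nu : {sigma_finite_measure set (n.-tuple T) -> \bar R})
    (Psi : n.+1.-tuple T -> R[i]) : cmeasurable Psi ->
  sqL2norm (cons_measure m nu) Psi = sqL2norm (m \x nu)%E (Psi \o @cons_pair _ T n).
Proof.
move=> mPsi; rewrite /sqL2norm ge0_integral_pushforward ?preimage_setT//.
- exact: measurable_cons_pair.
- exact: measurable_sqr_normc.
- by move=> y _; rewrite lee_fin sqr_ge0.
Qed.

Lemma cmeasurable_comp d d' (S : measurableType d) (T : measurableType d')
    (f : T -> R[i]) (g : S -> T) :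
  cmeasurable f -> measurable_fun setT g -> cmeasurable (f \o g).
Proof.
by move=> [mr mi] mg; split; rewrite compA; exact: measurableT_comp.
Qed.

Lemma negligible_integral_pinfty d (T : measurableType d)
    (m : {measure set T -> \bar R}) (g : T -> \bar R) :
  measurable_fun setT g -> (forall x, 0 <= g x)%E -> (\int[m]_x g x < +oo)%E ->
  m.-negligible (~` [set x | (g x < +oo)%E]).
Proof.
move=> mg g0 goo.
have ig : m.-integrable setT g.
  by apply/integrableP; split=> //; under eq_integral do rewrite gee0_abs//.
have := integrable_ae measurableT ig.
apply: negligibleS => x /= nx h; apply: nx.
by have := h Logic.I; rewrite ge0_fin_numE.
Qed.

(** * The 1-rdm as a series of Gram kernels *)

Section mixed.
Variables (n : nat) (Gamma : mixed_state R n.+1).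
Let f i := pure Gamma i \o @cons_pair _ (space3 R) n.

Lemma cmeasurable_pure_cons i : cmeasurable (f i).
Proof.
exact: cmeasurable_comp (pure_L2 Gamma i).1 (@measurable_cons_pair _ _ n).
Qed.

Lemma Re_rdm1 r s :
  cRe (rdm1 Gamma (r, s)) = n.+1%:R * gram_series (leb3N R n) (weight Gamma) f r s.
Proof.
have Re_natM (m : nat) (z : R[i]) : cRe (m%:R * z) = m%:R * cRe z.
  by rewrite -(rmorph_nat (real_complex R)); case: z => a b /=; rewrite mul0r subr0.
rewrite /rdm1 Re_natM /cseries /gram_series /=; congr (_ * _); congr (limn _);
  congr series.
by apply/funext => i /=; rewrite /cintegral /= mul0r subr0.
Qed.

Lemma Im_density r : cIm (density Gamma r) = 0.
Proof.
have Im_natM (m : nat) (z : R[i]) : cIm (m%:R * z) = m%:R * cIm z.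
  by rewrite -(rmorph_nat (real_complex R)); case: z => a b /=; rewrite mul0r addr0.
rewrite densityE Im_natM /cseries /=.
rewrite (_ : series _ = cst 0) ?lim_cst ?mulr0//.
by apply/funext => k; rewrite /series /= big1.
Qed.

(** By Tonelli, the series integrates to the sum of the weights times the squared norms of the pure
    states, which is 1; hence it is finite almost everywhere. *)
Lemma negligible_slice_norm_series_pinfty : (leb3 R).-negligible
  (~` [set r | (slice_norm_series (leb3N R n) (weight Gamma) f r < +oo)%E]).
Proof.
have mf := cmeasurable_pure_cons; have w0 := weight_ge0 Gamma.
apply: negligible_integral_pinfty.
- exact: measurable_slice_norm_series.
- by move=> r; apply: nneseries_ge0 => i _ _;
  rewrite mule_ge0 ?lee_fin ?slice_sqL2norm_ge0.
rewrite integral_nneseries//; last 2 first.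
- by move=> i; apply: measurable_funeM; exact: measurable_slice_sqL2norm.
- by move=> i r _; rewrite mule_ge0 ?lee_fin ?slice_sqL2norm_ge0.
have -> : (\sum_(0 <= i <oo) \int[leb3 R]_r
    ((weight Gamma i)%:E * slice_sqL2norm (leb3N R n) (f i) r) =
    \sum_(0 <= i <oo) (weight Gamma i)%:E)%E.
  apply: eq_eseriesr => i _.
  rewrite ge0_integralZl_EFin//; [|by move=> r _;
    exact: slice_sqL2norm_ge0|exact: measurable_slice_sqL2norm].
  rewrite integral_slice_sqL2norm// -sqL2norm_cons_measure;
    last by have [] := pure_L2 Gamma i.
  by rewrite [sqL2norm _ _](pure_normalized Gamma i) mule1.
have -> : (\sum_(0 <= i <oo) (weight Gamma i)%:E = 1%:E)%E.
  apply: cvg_lim => //.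
  rewrite (_ : (fun k => _) = EFin \o series (weight Gamma)); last first.
    by apply/funext => k; rewrite /series /= sumEFin.
  by apply: cvg_EFin; [exact: nearW|exact: weight_sum1].
by rewrite ltry.
Qed.

End mixed.

(** * The product of [G^dagger] and [G] as a Gram kernel *)

Section factor.
Context d (X : measurableType d).
Variable mu : {sigma_finite_measure set X -> \bar R}.
Variable G : X * X -> R[i].
(** The arguments are swapped because [gram] integrates over the second one, whereas the kernel
    product integrates over the first argument of [G]. *)
Let g : X * X -> R[i] := fun z => G (z.2, z.1).

(** The two integrands are complex conjugates of each other, so their real parts agree. *)
Lemma Re_kernel_product_dagger r s :
  cRe (kernel_product mu (kernel_dagger G) G (r, s)) = gram mu g r s.
Proof.
rewrite /kernel_product /cintegral /gram /=; apply: eq_Rintegral => z _ /=.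
by rewrite /g /kernel_dagger /=; case: (G (z, r)) (G (z, s)) => a b [c e] /=; ring.
Qed.

Lemma Im_kernel_product_dagger r :
  cIm (kernel_product mu (kernel_dagger G) G (r, r)) = 0.
Proof.
rewrite /kernel_product /cintegral /=.
under eq_Rintegral => z _.
  rewrite (_ : cIm _ = 0).
  over.
  by rewrite /kernel_dagger /=; case: (G (z, r)) => a b /=; ring.
by rewrite /Rintegral integral0.
Qed.

Hypothesis mG : cmeasurable G.

Lemma cmeasurable_swap : cmeasurable g.
Proof. exact: cmeasurable_comp mG (@measurable_swap _ _ X X). Qed.

Lemma negligible_slice_swap_pinfty : (sqL2norm (mu \x mu)%E G < +oo)%E ->
  mu.-negligible (~` [set r | (slice_sqL2norm mu g r < +oo)%E]).
Proof.
move=> Goo; apply: negligible_integral_pinfty.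
- by apply: measurable_slice_sqL2norm; exact: cmeasurable_swap.
- by move=> r; exact: slice_sqL2norm_ge0.
have G0 (z : X * X) : (0 <= (Normc.normc (G z) ^+ 2)%:E)%E by rewrite lee_fin
  sqr_ge0.
have := fubini_tonelli2 (m1 := mu) (m2 := mu) _ (measurable_sqr_normc mG) G0.
by rewrite /fubini_G => <-; exact: Goo.
Qed.

End factor.
End electron_kernels.

Theorem mainTheorem3 (R : realType) (n : nat)
    (D G : space3 R * space3 R -> R[i]) :
  one_rdm_of n.+1 D ->
  L2 (leb3x3 R) G ->
  (\forall x \ae leb3x3 R,
     D x = kernel_product (leb3 R) (kernel_dagger G) G x) ->
  forall Gamma : mixed_state R n.+1,
    maps_to Gamma D ->
    \forall r \ae leb3 R,
      density Gamma r = kernel_product (leb3 R) (kernel_dagger G) G (r, r).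
Proof.
move=> _ G2 DG Gamma GammaD.
pose p := weight Gamma.
pose f i := pure Gamma i \o @cons_pair _ (space3 R) n.
pose g : space3 R * space3 R -> R[i] := fun z => G (z.2, z.1).
have mf i : cmeasurable (f i) by exact: cmeasurable_pure_cons.
have mg : cmeasurable g by exact: cmeasurable_swap G2.1.
(* On [E1] and [E2] the respective Gram vectors have finite norm; both sets have negligible
   complement. *)
pose E1 := [set r | (slice_norm_series (leb3N R n) p f r < +oo)%E].
pose E2 := [set r | (slice_sqL2norm (leb3 R) g r < +oo)%E].
have mE1 : measurable E1.
  rewrite -[E1]setTI; apply: emeasurable_fun_infty_o => //.
  by apply: measurable_slice_norm_series => //; exact: weight_ge0.
have mE2 : measurable E2.
  rewrite -[E2]setTI; apply: emeasurable_fun_infty_o => //.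
  exact: measurable_slice_sqL2norm.
pose k1 r s := n.+1%:R * gram_series (leb3N R n) p f r s.
have diag : (leb3 R).-negligible
    [set r | (E1 `&` E2) r /\ k1 r r <> gram (leb3 R) g r r].
  apply: diag_unique.
  - exact: measurableI.
  - apply: measurable_funM => //;
    apply: measurable_funS (measurable_gram_series_diag _ _) => //.
    exact: weight_ge0.
  - by apply: measurable_funTS; exact: measurable_gram_diag.
  - apply: (small_on_pieces_sub (@subIsetl _ E1 E2)).
    have n0 : 0 < n.+1%:R :> R by rewrite ltr0n.
    have sk := small_gram_seriesB (mu := leb3 R) (nu := leb3N R n) (weight_ge0
      Gamma) mf.
    apply: small_on_pieces_le (small_on_piecesZ n0 sk) => r s _ _.
    by rewrite /k1 -mulrBr normrM ger0_norm ?EFinM// ltW.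
  - exact: small_on_pieces_sub (@subIsetr _ E1 E2) (small_gramB mg).
  (* Where the real kernels differ, [D] differs from the 1-rdm of [Gamma] or from the product built
     from [G], and both happen only on negligible sets. *)
  - have := negligibleU GammaD DG; apply: negligibleS => -[r s] /= k12.
    have [h1|] := pselect (rdm1 Gamma (r, s) = D (r, s)); last by left.
    have [h2|] := pselect (D (r,
      s) = kernel_product (leb3 R) (kernel_dagger G) G (r, s)); last by right.
    by exfalso; apply: k12; rewrite /k1 -Re_kernel_product_dagger -h2 -h1 Re_rdm1.
have := negligibleU diag (negligibleU (negligible_slice_norm_series_pinfty Gamma)
  (negligible_slice_swap_pinfty G2.1 G2.2)).
apply: negligibleS => r /= neq.
have [E1r|] := pselect (E1 r); last by right; left.
have [E2r|] := pselect (E2 r); last by right; right.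
left; split=> // kk; apply: neq.
(* Both imaginary parts vanish on the diagonal, so the equality of real parts gives the complex
   equality. *)
apply/eqP; rewrite eq_complex Im_density Im_kernel_product_dagger eqxx andbT.
by rewrite Re_kernel_product_dagger Re_rdm1 -kk.
Qed.
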